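(* Let $N\geq 1$, $q$ a prime power, and $k\in\{0,1,\dots,N-1\}$ such that $N+1=(N'+1)(k+1)$ for some $N'\in\{0,1,\dots,N-1\}$. Suppose that $\mathcal{P}$ is a point set of $\mathrm{PG}(N',q^{k+1})$ that is not contained in any $\mathbb{F}_q$-linear set of rank at most $N-k$. Then $\mathcal{F}_{N'+1,k+1,q}(\mathcal{P})$ is a higgledy-piggledy set of pairwise disjoint $k$-subspaces in $\mathrm{PG}(N,q)$.
   Context: $\mathrm{PG}(N,q)$ denotes the Desarguesian projective space of dimension $N$ over $\mathbb{F}_q$. A strong $k$-blocking set of $\mathrm{PG}(N,q)$ is a point set meeting every $(N-k)$-subspace $\kappa$ in a point set spanning $\kappa$; a set $\mathcal{K}$ of $k$-subspaces is higgledy-piggledy if the union of its elements' points is a strong $k$-blocking set. Field reduction: identifying $\mathbb{F}_{q^{k+1}}^{N'+1}$ with $\mathbb{F}_q^{(N'+1)(k+1)}$ as $\mathbb{F}_q$-vector spaces gives the field reduction map $\mathcal{F}_{N'+1,k+1,q}:\mathrm{PG}(N',q^{k+1})\to\mathrm{PG}((N'+1)(k+1)-1,q)$, sending a subspace (in particular a point, i.e. a 1-dimensional $\mathbb{F}_{q^{k+1}}$-subspace) to the projective subspace of the corresponding $\mathbb{F}_q$-subspace; each point is mapped to a $k$-subspace. For a point set $\mathcal{P}$, $\mathcal{F}_{N'+1,k+1,q}(\mathcal{P})=\{\mathcal{F}_{N'+1,k+1,q}(P):P\in\mathcal{P}\}$. The images of all points form the Desarguesian $k$-spread $\mathcal{D}_{N'+1,k+1,q}$.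 A point set $\mathcal{P}$ of $\mathrm{PG}(N',q^{k+1})$ is an $\mathbb{F}_q$-linear set of rank $k'$ if there is a $(k'-1)$-subspace $\kappa$ of $\mathrm{PG}((N'+1)(k+1)-1,q)$ such that $\mathcal{F}_{N'+1,k+1,q}(\mathcal{P})$ is exactly the set of elements of $\mathcal{D}_{N'+1,k+1,q}$ meeting $\kappa$, with $k'$ minimal with this property. *)

(* Defs.v *)
From mathcomp Require Import all_boot all_order all_algebra.
From mathcomp Require Import boolp classical_sets.

Set Implicit Arguments.
Unset Strict Implicit.
Unset Printing Implicit Defensive.

Import GRing.Theory.
Local Open Scope classical_set_scope.
Local Open Scope ring_scope.

(* PG(N, K) is the lattice {vspace 'rV[K]_N.+1}; projective dimension d is
   vector dimension d + 1, so 0%VS is the empty subspace and points are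
   1-dimensional vector subspaces. *)
Definition psubspace (K : fieldType) (N d : nat) :
    set {vspace 'rV[K]_N.+1} :=
  [set U | \dim U = d.+1].

Definition ppoint (K : fieldType) (N : nat) : set {vspace 'rV[K]_N.+1} :=
  @psubspace K N 0.

Definition points_of (K : fieldType) (N : nat) (U : {vspace 'rV[K]_N.+1}) :
    set {vspace 'rV[K]_N.+1} :=
  [set p | ppoint p /\ (p <= U)%VS].

Definition spans (K : fieldType) (N : nat) (B : set {vspace 'rV[K]_N.+1})
    (U : {vspace 'rV[K]_N.+1}) : Prop :=
  (forall p, B p -> (p <= U)%VS) /\
  (forall W : {vspace 'rV[K]_N.+1},
     (forall p, B p -> (p <= W)%VS) -> (U <= W)%VS).

Definition strong_blocking_set (K : fieldType) (N k : nat)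
    (B : set {vspace 'rV[K]_N.+1}) : Prop :=
  B `<=` @ppoint K N /\
  forall kappa : {vspace 'rV[K]_N.+1}, psubspace (N - k) kappa ->
    spans (B `&` points_of kappa) kappa.

Definition higgledy_piggledy (K : fieldType) (N k : nat)
    (S : set {vspace 'rV[K]_N.+1}) : Prop :=
  S `<=` @psubspace K N k /\
  strong_blocking_set k (\bigcup_(U in S) points_of U).

Definition pairwise_disjoint (K : fieldType) (N : nat)
    (S : set {vspace 'rV[K]_N.+1}) : Prop :=
  forall U W, S U -> S W -> U <> W -> (U :&: W = 0)%VS.

(* phi identifies L^(M+1), as a vector space over F through iota, with
   F^(N+1). *)
Definition reduction_iso (F L : fieldType) (iota : {rmorphism F -> L})
    (M N : nat) (phi : 'rV[L]_M.+1 -> 'rV[F]_N.+1) : Prop :=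
  bijective phi /\
  forall (a : F) (u v : 'rV[L]_M.+1),
    phi (iota a *: u + v) = a *: phi u + phi v.

(* When phi is a reduction_iso, the image of U under phi is already an
   F-subspace, so taking the span adds nothing: see mem_field_reduction. *)
Definition field_reduction (F L : finFieldType) (M N : nat)
    (phi : 'rV[L]_M.+1 -> 'rV[F]_N.+1) (U : {vspace 'rV[L]_M.+1}) :
    {vspace 'rV[F]_N.+1} :=
  <<[seq phi x | x in U]>>%VS.

Definition desarguesian_spread (F L : finFieldType) (M N : nat)
    (phi : 'rV[L]_M.+1 -> 'rV[F]_N.+1) : set {vspace 'rV[F]_N.+1} :=
  field_reduction phi @` @ppoint L M.

Definition linear_set_of (F L : finFieldType) (M N : nat)
    (phi : 'rV[L]_M.+1 -> 'rV[F]_N.+1) (kappa : {vspace 'rV[F]_N.+1})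
    (P : set {vspace 'rV[L]_M.+1}) : Prop :=
  P `<=` @ppoint L M /\
  field_reduction phi @` P =
    desarguesian_spread phi `&` [set S | (S :&: kappa)%VS <> 0%VS].

Definition linear_set_of_rank (F L : finFieldType) (M N : nat)
    (phi : 'rV[L]_M.+1 -> 'rV[F]_N.+1) (r : nat)
    (P : set {vspace 'rV[L]_M.+1}) : Prop :=
  (exists kappa, \dim kappa = r /\ linear_set_of phi kappa P) /\
  (forall kappa, linear_set_of phi kappa P -> (r <= \dim kappa)%N).

Lemma mem_field_reduction (F L : finFieldType) (iota : {rmorphism F -> L})
    (M N : nat) (phi : 'rV[L]_M.+1 -> 'rV[F]_N.+1)
    (U : {vspace 'rV[L]_M.+1}) (x : 'rV[L]_M.+1) :
  reduction_iso iota phi -> (phi x \in field_reduction phi U) = (x \in U).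
Proof.
move=> [phi_bij phi_lin]; have phi_inj := bij_inj phi_bij.
have phi0 : phi 0 = 0.
  have := phi_lin 1 0 0; rewrite scaler0 addr0 scale1r.
  by move/(congr1 (fun y => y - phi 0)); rewrite subrr addrK => <-.
apply/idP/idP => [|xU]; last by apply: memv_span; apply: map_f; rewrite mem_enum.
suff sub s : {subset s <= [seq phi y | y in U]} ->
    forall v, v \in <<s>>%VS -> v \in [seq phi y | y in U].
  move=> /(sub _ (fun _ => id)) /mapP[y]; rewrite mem_enum => yU.
  by move/phi_inj ->.
elim: s => [_ v|w s IHs sU v].
  rewrite span_nil memv0 => /eqP ->; rewrite -phi0.
  by apply: map_f; rewrite mem_enum mem0v.
have /mapP[u] := sU _ (mem_head w s); rewrite mem_enum => uU ->.
rewrite span_cons => /memv_addP[_ /vlineP[a ->] [z zs ->]].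
have {zs}/IHs/mapP[y ys|t] := zs; first by apply: sU; rewrite inE ys orbT.
rewrite mem_enum => tU ->.
by rewrite -phi_lin; apply: map_f; rewrite mem_enum memvD ?memvZ.
Qed.

(* Main.v *)
Require Import Defs.
From mathcomp Require Import all_boot all_order all_algebra.
From mathcomp Require Import finfield.
From mathcomp Require Import boolp classical_sets.

Set Implicit Arguments.
Unset Strict Implicit.
Unset Printing Implicit Defensive.

Import GRing.Theory.
Local Open Scope classical_set_scope.
Local Open Scope ring_scope.

(** Suppose the points of the spread elements inside an (N - k)-subspace kappa
    lie in a subspace W that does not contain kappa. By dimension, every
    k-subspace meets kappa, so every element of the field reduction of P meets
    the proper subspace W :&: kappa of kappa. Hence P lies in the linear set
    defined by W :&: kappa, whose rank is at most the vector dimension of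
    W :&: kappa, and so at most N - k. *)

Lemma reduction_iso0 (F L : fieldType) (iota : {rmorphism F -> L}) (M N : nat)
    (phi : 'rV[L]_M.+1 -> 'rV[F]_N.+1) :
  reduction_iso iota phi -> phi 0 = 0.
Proof.
move=> [_ phi_lin]; have := phi_lin 1 0 0.
by rewrite scaler0 addr0 scale1r => /esym/(canRL (addrK _)); rewrite subrr.
Qed.

(** As [phi] is onto, every vector is some [phi x], so the reduction of [U] is exactly the image of
    [U] under the injection [phi]. *)
Lemma card_field_reduction (F L : finFieldType) (iota : {rmorphism F -> L})
    (M N : nat) (phi : 'rV[L]_M.+1 -> 'rV[F]_N.+1) (U : {vspace 'rV[L]_M.+1}) :
  reduction_iso iota phi -> #|field_reduction phi U| = #|U|.
Proof.
move=> phi_iso; have [phi_bij _] := phi_iso.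
rewrite -(card_imset _ (bij_inj phi_bij)); apply: eq_card => y.
have [psi _ psiK] := phi_bij.
rewrite -[y]psiK (mem_field_reduction _ _ phi_iso).
by rewrite (mem_imset _ _ (bij_inj phi_bij)).
Qed.

(** Counting replaces the choice of a basis of [L] over [F]: both spaces have the same number of
    vectors, and powers of [#|F|], which exceeds 1, determine their exponents. *)
Lemma dim_field_reduction (F L : finFieldType) (iota : {rmorphism F -> L})
    (M N d : nat) (phi : 'rV[L]_M.+1 -> 'rV[F]_N.+1)
    (U : {vspace 'rV[L]_M.+1}) :
  reduction_iso iota phi -> #|L| = (#|F| ^ d)%N ->
  \dim (field_reduction phi U) = (d * \dim U)%N.
Proof.
move=> phi_iso cardL; have := card_field_reduction U phi_iso.
by rewrite !card_vspace cardL -expnM => /expnI-> //; apply: finNzRing_gt1.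
Qed.

Lemma ppoint_vline (K : fieldType) (N : nat) (p : {vspace 'rV[K]_N.+1})
    (v : 'rV[K]_N.+1) :
  ppoint p -> v \in p -> v != 0 -> p = <[v]>%VS.
Proof.
move=> p1 vp v_neq0; apply/esym/eqP.
by rewrite eqEdim -memvE vp dim_vline v_neq0 p1.
Qed.

(** A common nonzero vector pulls back along [phi] to a nonzero vector that spans both points over
    [L]. *)
Lemma field_reduction_disjoint (F L : finFieldType) (iota : {rmorphism F -> L})
    (M N : nat) (phi : 'rV[L]_M.+1 -> 'rV[F]_N.+1)
    (P : set {vspace 'rV[L]_M.+1}) :
  reduction_iso iota phi -> P `<=` @ppoint L M ->
  pairwise_disjoint (field_reduction phi @` P).
Proof.
move=> phi_iso P1 _ _ [p Pp <-] [p' Pp' <-] neq_pp'.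
have [[psi _ psiK] _] := phi_iso.
apply/eqP; rewrite -subv0; apply/subvP => y; rewrite -[y]psiK memv_cap memv0.
rewrite !(mem_field_reduction _ _ phi_iso) => /andP[yp yp'].
have [->|y_neq0] := eqVneq (psi y) 0; first by rewrite (reduction_iso0 phi_iso).
case: neq_pp'.
by rewrite (ppoint_vline (P1 _ Pp) yp y_neq0) (ppoint_vline (P1 _ Pp') yp' y_neq0).
Qed.

Definition linear_set (F L : finFieldType) (M N : nat)
    (phi : 'rV[L]_M.+1 -> 'rV[F]_N.+1) (kappa : {vspace 'rV[F]_N.+1}) :
    set {vspace 'rV[L]_M.+1} :=
  [set p | ppoint p /\ (field_reduction phi p :&: kappa)%VS <> 0%VS].

Lemma linear_set_ofP (F L : finFieldType) (M N : nat)
    (phi : 'rV[L]_M.+1 -> 'rV[F]_N.+1) (kappa : {vspace 'rV[F]_N.+1}) :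
  linear_set_of phi kappa (linear_set phi kappa).
Proof.
split=> [p []//|]; apply/seteqP; split=> [_ [p [p1 pk] <-]|_ [[p p1 <-] pk]].
  by split=> //; exists p.
by exists p.
Qed.

(** The rank is a minimum over all subspaces defining [X], so [kappa] only bounds it from above. The
    minimum is attained because dimensions are natural numbers. *)
Lemma linear_set_of_has_rank (F L : finFieldType) (M N : nat)
    (phi : 'rV[L]_M.+1 -> 'rV[F]_N.+1) (kappa : {vspace 'rV[F]_N.+1})
    (X : set {vspace 'rV[L]_M.+1}) :
  linear_set_of phi kappa X ->
  exists2 r, (r <= \dim kappa)%N & linear_set_of_rank phi r X.
Proof.
move=> kX; pose Q r := `[< exists k', \dim k' = r /\ linear_set_of phi k' X >].
have Qk k' : linear_set_of phi k' X -> Q (\dim k').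
  by move=> k'X; apply/asboolP; exists k'.
have exQ : exists r, Q r by exists (\dim kappa); apply: Qk.
case: (ex_minnP exQ) => r /asboolP Qr r_min.
by exists r; [apply/r_min/Qk | split=> // k' /Qk/r_min].
Qed.

Lemma capv_neq0 (K : fieldType) (vT : vectType K) (U V : {vspace vT}) :
  (\dim {:vT} < \dim U + \dim V)%N -> (U :&: V)%VS <> 0%VS.
Proof.
move=> ltUV UV0; move: ltUV.
by rewrite -dimv_sum_cap UV0 dimv0 addn0 ltnNge dimvS ?subvf.
Qed.

(** Passes from points to vectors: each nonzero vector of [U :&: kappa] spans a point of the
    blocking set inside [kappa]. *)
Lemma points_of_bigcup_sub (K : fieldType) (N : nat)
    (S : set {vspace 'rV[K]_N.+1}) (U kappa W : {vspace 'rV[K]_N.+1}) :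
  S U ->
  (forall p, (\bigcup_(V in S) points_of V `&` points_of kappa) p ->
    (p <= W)%VS) ->
  (U :&: kappa <= W)%VS.
Proof.
move=> SU BW; apply/subvP => x; rewrite memv_cap => /andP[xU xk].
have [->|x_neq0] := eqVneq x 0; first exact: mem0v.
have x1 : ppoint <[x]>%VS by rewrite /ppoint /psubspace /= dim_vline x_neq0.
rewrite memvE; apply: BW; split; last by split=> //; rewrite -memvE.
by exists U => //; split=> //; rewrite -memvE.
Qed.

Theorem mainTheorem6 (N q k N' : nat) (F L : finFieldType)
    (iota : {rmorphism F -> L})
    (phi : 'rV[L]_N'.+1 -> 'rV[F]_N.+1)
    (P : set {vspace 'rV[L]_N'.+1})
    (hN : (1 <= N)%N) (hk : (k <= N - 1)%N) (hN' : (N' <= N - 1)%N)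
    (hNk : (N + 1 = (N' + 1) * (k + 1))%N)
    (hF : #|F| = q) (hL : #|L| = (q ^ (k + 1))%N)
    (hphi : reduction_iso iota phi)
    (hP : P `<=` @ppoint L N')
    (hPlin : forall (r : nat) (X : set {vspace 'rV[L]_N'.+1}),
       (r <= N - k)%N -> linear_set_of_rank phi r X -> ~ (P `<=` X)) :
  higgledy_piggledy k (field_reduction phi @` P) /\
  pairwise_disjoint (field_reduction phi @` P).
Proof.
split; last exact: field_reduction_disjoint hphi hP.
have dimP p : P p -> \dim (field_reduction phi p) = k.+1.
  by move=> /hP p1; rewrite (dim_field_reduction _ hphi (d := k.+1)) ?p1 ?muln1
    // hF hL addn1.
have le_kN : (k <= N)%N by apply: leq_trans hk (leq_subr _ _).
split=> [_ [p Pp <-]|]; first exact: dimP.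
split=> [p [_ _ []]//|kappa dim_kappa].
split=> [p [_ []]//|W BW]; apply: contrapT => nsub_kW.
(* The vector dimension of [kappa] is [N - k + 1], and being a proper subspace costs one
   dimension. *)
have dimW : (\dim (W :&: kappa) <= N - k)%N.
  rewrite -ltnS -dim_kappa ltnNge; apply/negP => le_dim; apply: nsub_kW.
  apply/capv_idPr/eqP; rewrite eqEdim capvSr; exact: le_dim.
have [r le_r rankr] := linear_set_of_has_rank (linear_set_ofP phi (W :&: kappa)).
case: (hPlin _ _ (leq_trans le_r dimW) rankr) => p Pp.
split; first exact: hP.
(* Intersecting further with [W] loses nothing, so it is enough to meet [kappa] itself. *)
have <- : (field_reduction phi p :&: kappa
           = field_reduction phi p :&: (W :&: kappa))%VS.
  rewrite capvA [(_ :&: W)%VS]capvC -capvA; apply/esym/capv_idPr.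
  by apply: points_of_bigcup_sub BW; exists p.
(* The vector dimensions [k + 1] and [N - k + 1] add up to [N + 2], one more than that of the whole
   space. *)
apply: capv_neq0; rewrite dimP // dim_kappa dimvf /dim /= mul1n.
by rewrite addSnnS !addnS subnKC.
Qed.
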